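(* Let $m$ be a positive integer. For each $1\le i\le m$ let $k_i\ge 2$ and let $\tau_i\in\mathcal{S}_{k_i}$ satisfy $\tau_i(k_i-1)=k_i-1$ and $\tau_i(k_i)=k_i$, and define $\widetilde\tau_i\in\mathcal{S}_{k_i}$ by $\widetilde\tau_i(j)=\tau_i(j)$ for $1\le j\le k_i-2$, $\widetilde\tau_i(k_i-1)=k_i$, $\widetilde\tau_i(k_i)=k_i-1$. Then the sets $\{\tau_1,\dots,\tau_m\}$ and $\{\widetilde\tau_1,\dots,\widetilde\tau_m\}$ are forest-shape-Wilf equivalent.
   Context: Let $F$ be an unlabeled rooted forest. A forest-Young diagram on $F$ is a finite set $Y$ of pairs $(r,v)$ with $r$ a positive integer and $v$ a vertex of $F$ such that: $(1,v)\in Y$ for all vertices $v$; if $(r,v)\in Y$ then $(r',v)\in Y$ for all $1\le r'\le r$; if $(r,v)\in Y$ then $(r,v')\in Y$ for every descendant $v'$ of $v$. The column of $v$ is $\{(r,v)\in Y\}$, the $r$th row is $\{(r,v)\in Y\}$. A transversal of $Y$ is a labeling of the elements of $Y$ by $0$'s and $1$'s such that every nonempty row and every column contains exactly one $1$; $S_Y$ denotes the set of transversals. For a $k\times k$ permutation matrix $M$, a transversal $T$ contains $M$ if there are vertices $v_1,\dots,v_k$ of $F$ with $v_i$ a strict ancestor of $v_j$ for $i<j$, and row indices $r_1<\cdots<r_k$, such that for all $1\le i,j\le k$ we have $(r_i,v_j)\in Y$ and the label of $(r_i,v_j)$ equals the $(i,j)$ entry of $M$; otherwise $T$ avoids $M$.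 For a set $\mathcal{M}$ of permutation matrices, $S_Y(\mathcal{M})$ is the set of transversals of $Y$ avoiding every $M\in\mathcal{M}$. Two sets $\mathcal{M},\mathcal{M}'$ are forest-shape-Wilf equivalent if $|S_Y(\mathcal{M})|=|S_Y(\mathcal{M}')|$ for every forest-Young diagram $Y$ on every rooted forest. A permutation $\sigma\in\mathcal{S}_k$ is identified with the $k\times k$ permutation matrix whose $(i,j)$ entry is $\delta_{i,k+1-\sigma(j)}$, and a set of permutations with the corresponding set of matrices; thus sets of permutations are forest-shape-Wilf equivalent if the corresponding sets of matrices are. *)

(* Defs.v *)
From HB Require Import structures.
From mathcomp Require Import all_boot all_order all_fingroup all_algebra.
From mathcomp Require Import finmap.
From mathcomp Require Import boolp classical_sets.

Set Implicit Arguments.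
Unset Strict Implicit.
Unset Printing Implicit Defensive.

Local Open Scope nat_scope.
Local Open Scope fset_scope.
Local Open Scope classical_set_scope.

Definition parent_rel (V : finType) (parent : V -> option V) : rel V :=
  fun w u => parent w == Some u.

(* [w] has a parent, from which [u] is reached by following parents. *)
Definition strict_anc (V : finType) (parent : V -> option V) : rel V :=
  fun u w => [exists p, parent_rel parent w p && connect (parent_rel parent) p u].

(* Finite rooted forests: the roots are the vertices whose parent is [None]. *)
Record rooted_forest := RootedForest {
  vertex :> finType;
  parent : vertex -> option vertex;
  parent_acyclic : forall v, ~~ strict_anc parent v v
}.

Definition strict_ancestor (F : rooted_forest) : rel F :=
  strict_anc (@parent F).

(* Rows are numbered from 1. *)
Record forest_Young_diagram (F : rooted_forest) := ForestYoungDiagram {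
  cells : {fset nat * F};
  cells_row_gt0 : forall r v, (r, v) \in cells -> 0 < r;
  cells_first_row : forall v, (1, v) \in cells;
  cells_column : forall r r' v,
    (r, v) \in cells -> 1 <= r' <= r -> (r', v) \in cells;
  cells_descendant : forall r v v',
    (r, v) \in cells -> strict_ancestor v v' -> (r, v') \in cells
}.

(* The label 1 is [true]. *)
Definition labeling (F : rooted_forest) (Y : forest_Young_diagram F) : finType :=
  {ffun cells Y -> bool}.

Definition is_FYD_transversal (F : rooted_forest) (Y : forest_Young_diagram F)
    (T : labeling Y) : Prop :=
  (forall r : nat, (exists v : F, (r, v) \in cells Y) ->
     #|[pred c : cells Y | ((val c).1 == r) && T c]| = 1) /\
  (forall v : F, #|[pred c : cells Y | ((val c).2 == v) && T c]| = 1).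

Definition perm_matrix (k : nat) : Type := {M : 'M[nat]_k | is_perm_mx M}.

Definition contains (F : rooted_forest) (Y : forest_Young_diagram F)
    (T : labeling Y) (k : nat) (M : perm_matrix k) : Prop :=
  exists (v : 'I_k -> F) (r : 'I_k -> nat),
    [/\ forall i j : 'I_k, i < j -> strict_ancestor (v i) (v j),
        forall i j : 'I_k, i < j -> r i < r j
      & forall i j : 'I_k, exists c_in : (r i, v j) \in cells Y,
          nat_of_bool (T [` c_in]) = val M i j].

Definition avoiding_transversal (F : rooted_forest) (Y : forest_Young_diagram F)
    (MM : set {k : nat & perm_matrix k}) (T : labeling Y) : Prop :=
  is_FYD_transversal T /\ forall M, MM M -> ~ contains T (tagged M).

(* The number |S_Y(MM)|. *)
Definition num_avoiding (F : rooted_forest) (Y : forest_Young_diagram F)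
    (MM : set {k : nat & perm_matrix k}) : nat :=
  #|[pred T : labeling Y | `[< avoiding_transversal MM T >]]|.

Definition forest_shape_Wilf_equivalent
    (MM MM' : set {k : nat & perm_matrix k}) : Prop :=
  forall (F : rooted_forest) (Y : forest_Young_diagram F),
    num_avoiding Y MM = num_avoiding Y MM'.

(* With indices counted from 0, k + 1 - sigma(j) becomes [rev_ord (sigma j)]. *)
Definition mx_of_perm (k : nat) (sigma : 'S_k) : 'M[nat]_k :=
  \matrix_(i, j) nat_of_bool (i == rev_ord (sigma j)).

Lemma mx_of_perm_is_perm_mx (k : nat) (sigma : 'S_k) :
  is_perm_mx (mx_of_perm sigma).
Proof.
apply/is_perm_mxP; exists (perm (@rev_ord_inj k) * sigma^-1)%g.
apply/matrixP => i j; rewrite !mxE permM (permE (@rev_ord_inj k)).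
rewrite -(inj_eq (@rev_ord_inj k) i) rev_ordK.
by rewrite (canF_eq (permKV sigma)); case: (_ == _).
Qed.

Definition perm_matrix_of_perm (k : nat) (sigma : 'S_k) : perm_matrix k :=
  exist _ (mx_of_perm sigma) (mx_of_perm_is_perm_mx sigma).

Definition tagged_matrix_of_perm (s : {k : nat & 'S_k}) :
    {k : nat & perm_matrix k} :=
  Tagged perm_matrix (perm_matrix_of_perm (tagged s)).

Definition perms_forest_shape_Wilf_equivalent
    (A B : set {k : nat & 'S_k}) : Prop :=
  forest_shape_Wilf_equivalent (tagged_matrix_of_perm @` A)
                               (tagged_matrix_of_perm @` B).

(* Main.v *)
(* Call a cell dominated if some matrix, stripped of its last two columns and two
   lowest rows, occurs in strictly higher rows and strict ancestor columns.
   Since the stripped patterns of [tau i] and [tau' i] agree, a transversal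
   contains some [tau i] (resp. [tau' i]) iff there are a vertex [y] and a strict
   descendant [w] whose rows decrease (resp. increase) from [y] to [w], the
   column of [y] being dominated at the higher of the two rows.  Domination is
   unaffected when dominated 1s are moved within the dominated region.

   For a vertex [x] whose 1 is dominated, let [Q] be the set of rows in which the
   column of [x] is dominated and that carry a 1 from the subtree of [x].
   Avoiding the [tau' i] (resp. the [tau i]) means that the row of each such [x]
   is the maximum (resp. minimum) of its [Q].  Rotating the 1s in the rows [Q]
   cyclically upwards turns "maximum" into "minimum" at [x], and preserves the
   conditions at all other vertices: below [x] the relative order is kept, above
   [x] only the set of rows used by the subtree matters, and incomparable
   subtrees are disjoint.  So the conditions can be switched one vertex at a
   time. *)
Require Import Defs.
From HB Require Import structures.
From mathcomp Require Import all_boot all_order all_fingroup all_algebra.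
From mathcomp Require Import finmap.
From mathcomp Require Import boolp classical_sets.
From mathcomp Require Import zify.

Set Implicit Arguments.
Unset Strict Implicit.
Unset Printing Implicit Defensive.

Local Open Scope nat_scope.
Local Open Scope classical_set_scope.

(** * Cyclic successor in a sorted list *)

Section NextSorted.
Variables (T : eqType) (le : rel T) (s : seq T) (m : T).
Hypotheses (le_refl : reflexive le) (le_trans : transitive le)
  (le_anti : antisymmetric le).
Hypotheses (s_sorted : sorted le s) (s_uniq : uniq s).
Hypotheses (m_in : m \in s) (m_max : forall b, b \in s -> le b m).

Lemma index_sorted_max a : a \in s -> ((index a s).+1 == size s) = (a == m).
Proof.
move=> a_in.
have ltm : index m s < size s by rewrite index_mem.
have lta : index a s < size s by rewrite index_mem.
have index_last b : b \in s -> index b s <= (size s).-1.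
  by move=> b_in; rewrite -ltnS prednK ?index_mem //; case: (s) b_in.
pose l := nth m s (size s).-1.
have lt_last : (size s).-1 < size s by lia.
have l_in : l \in s by apply: mem_nth.
have il : index l s = (size s).-1 by rewrite index_uniq.
have lm : l = m.
  apply: le_anti; rewrite m_max //=.
  by apply: (sorted_leq_index le_trans le_refl s_sorted); rewrite // il index_last.
apply/eqP/eqP => [ia|->]; last by rewrite -lm il; lia.
by rewrite -lm /l -ia /= nth_index.
Qed.

(** The maximum is last in the sorted list, so its cyclic successor wraps around to the head. *)
Lemma next_max_min b : b \in s -> le (next s m) b.
Proof.
move=> b_in; have := index_sorted_max m_in; rewrite eqxx next_nth m_in => /eqP.
case: s s_sorted b_in => // z s' /= zs' b_in im.
rewrite nth_default; last by lia.
move: b_in; rewrite inE => /orP[/eqP->//|b_in].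
exact: (allP (order_path_min le_trans zs')).
Qed.

Lemma next_homo a b : a \in s -> b \in s -> a != m -> b != m ->
  le a b -> le (next s a) (next s b).
Proof.
move=> a_in b_in am bm ab.
have iab : index a s <= index b s.
  rewrite leqNgt; apply/negP => ltba.
  have ba := sorted_leq_index le_trans le_refl s_sorted _ _ b_in a_in (ltnW ltba).
  have eab : a = b by apply: le_anti; rewrite ab ba.
  by move: ltba; rewrite eab ltnn.
have /eqP ia := index_sorted_max a_in; have /eqP ib := index_sorted_max b_in.
move: (a_in) (b_in); rewrite -!index_mem => lta ltb.
(* Elements other than the maximum are not last, so [next] does not wrap around at them. *)
have {ia}lta : (index a s).+1 < size s by move: ia; rewrite (negbTE am); lia.
have {ib}ltb : (index b s).+1 < size s by move: ib; rewrite (negbTE bm); lia.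
rewrite !next_nth a_in b_in.
case: (s) s_sorted lta ltb iab => // z s' zs' lta ltb iab.
exact: (sorted_leq_nth le_trans le_refl z zs' _ _ lta ltb iab).
Qed.

End NextSorted.

Lemma next_inj (T : eqType) (s : seq T) : uniq s -> injective (next s).
Proof. by move=> /prev_next; apply: can_inj. Qed.

(** * The strict ancestor order of a rooted forest *)

Section Ancestors.
Variable F : rooted_forest.
Implicit Types u v w : F.
Notation anc := (@strict_ancestor F).
Notation up := (connect (parent_rel (@parent F))).

Lemma ancE u w : anc u w <-> exists2 p, parent w = Some p & up p u.
Proof.
split; first by case/existsP => p /andP[/eqP]; exists p.
by case=> p wp pu; apply/existsP; exists p; rewrite /parent_rel wp eqxx.
Qed.

Lemma anc_irr : irreflexive anc.
Proof. by move=> v; apply/negbTE/parent_acyclic. Qed.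

Lemma anc_up u w : anc u w -> up w u.
Proof.
case/ancE => p wp; apply: connect_trans; apply: connect1.
by rewrite /parent_rel wp.
Qed.

Lemma anc_trans : transitive anc.
Proof.
move=> v u w uv /ancE[p wp pv]; apply/ancE; exists p => //.
exact: connect_trans pv (anc_up uv).
Qed.

Lemma up_eqVanc u w : up w u -> w = u \/ anc u w.
Proof.
case/connectP => [[|p s] /= ]; first by left.
case/andP => /eqP wp ps ->; right; apply/ancE; exists p => //.
by apply/connectP; exists s.
Qed.

(** Parents are unique, so two upward paths from [w] agree until one of them stops. *)
Lemma up_chain u v w : up w u -> up w v -> up u v \/ up v u.
Proof.
case/connectP => s; elim: s w => [|p s IH] w /=; first by move=> _ ->; left.
case/andP => /eqP wp ps eu /up_eqVanc[<-|/ancE[p']].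
  right; apply/connectP; exists (p :: s) => //=.
  by rewrite /parent_rel wp eqxx.
by rewrite wp => -[<-]; apply: IH.
Qed.

Lemma anc_chain u v w : anc u w -> anc v w -> [\/ u = v, anc u v | anc v u].
Proof.
move=> /anc_up wu /anc_up wv.
case: (up_chain wu wv) => /up_eqVanc[->|]; [exact: Or31 | | exact: Or31 |].
- exact: Or33.
- exact: Or32.
Qed.

(** The number of strict ancestors drops when passing to a strict ancestor, by transitivity and
    irreflexivity. *)
Lemma anc_ind (Q : F -> Prop) :
  (forall v, (forall u, anc u v -> Q u) -> Q v) -> forall v, Q v.
Proof.
move=> H v; have [n] := ubnP #|[pred u | anc u v]|.
elim: n v => // n IH v le_n; apply: H => u uv; apply: IH.
rewrite (leq_trans _ (le_n : _ <= n)) //; apply/proper_card/properP; split.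
  by apply/fintype.subsetP => w; rewrite !inE => /anc_trans; apply.
by exists u; rewrite !inE ?uv ?anc_irr.
Qed.

End Ancestors.

(** * Domination and the family of conditions to interpolate *)

Section Dominated.
Variables (F : rooted_forest) (Y : forest_Young_diagram F).
(** [occ f A] is to be read: under the row assignment [f], some stripped pattern occurs on vertices
    of [A]. *)
Variable occ : (F -> nat) -> (F -> Prop) -> Prop.
Hypothesis occ_ext : forall (f g : F -> nat) (A : F -> Prop),
  (forall u, A u -> f u = g u) -> occ f A -> occ g A.
Notation anc := (@strict_ancestor F).

(* [A] stands for the first [k_i - 2] columns of a would-be occurrence: the
   pattern is completed by any two 1s, in the right order, of the dominated
   region. *)
Definition dominated (f : F -> nat) (r : nat) (v : F) : Prop :=
  (r, v) \in cells Y /\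
  exists2 A, occ f A & forall u, A u -> anc u v /\ r < f u.

Lemma dominated_row f r r' v :
  0 < r' <= r -> dominated f r v -> dominated f r' v.
Proof.
move=> r'r [rv [A fA Av]]; split; first exact: cells_column rv r'r.
exists A => // u /Av[-> ru]; split=> //; lia.
Qed.

Lemma dominated_desc f r v w : anc v w -> dominated f r v -> dominated f r w.
Proof.
move=> vw [rv [A fA Av]]; split; first exact: cells_descendant rv vw.
by exists A => // u /Av[uv ru]; split=> //; apply: anc_trans vw.
Qed.

(* An occurrence through a dominated 1 can be traded for one that dominates that
   1, which lies strictly closer to the root. *)
Lemma undominated_occurrence f v r : dominated f r v ->
  exists2 A, occ f A &
    forall u, A u -> [/\ anc u v, r < f u & ~ dominated f (f u) u].
Proof.
elim/anc_ind: v r => v IH r [rv [A fA Av]].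
have [[u [Au du]]|nd] := pselect (exists u, A u /\ dominated f (f u) u).
  have [uv ru] := Av _ Au.
  have [B fB Bu] := IH _ uv _ du; exists B => // w /Bu[wu uw nd].
  by split=> //; [apply: anc_trans uv | apply: ltn_trans uw].
exists A => // u Au; have [uv ru] := Av _ Au; split=> // du; apply: nd.
by exists u.
Qed.

(** Domination is always witnessed by undominated 1s, and these do not move. The inclusion from [f]
    to [g] comes first, since the converse uses it to see that a 1 undominated for [g] has not
    moved. *)
Lemma dominated_invariant f g :
  (forall v, g v = f v \/ dominated f (f v) v /\ dominated f (g v) v) ->
  forall r v, dominated g r v <-> dominated f r v.
Proof.
move=> fg; have sub r v : dominated f r v -> dominated g r v.
  move=> dv; have [A fA Av] := undominated_occurrence dv.
  split; first by case: dv.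
  have efg u : A u -> f u = g u.
    by move=> /Av[_ _ nd]; have [->//|[]] := fg u.
  exists A; first exact: occ_ext efg fA.
  by move=> u Au; have [uv ru _] := Av _ Au; rewrite -efg.
move=> r v; split=> [dv|]; last exact: sub.
have [A gA Av] := undominated_occurrence dv.
split; first by case: dv.
have efg u : A u -> g u = f u.
  by move=> /Av[_ _ nd]; have [->//|[_ /sub]] := fg u.
exists A; first exact: occ_ext efg gA.
by move=> u Au; have [uv ru _] := Av _ Au; rewrite -efg.
Qed.

Variable K : nat.
Implicit Types f : {ffun F -> 'I_K}.

Definition rows f : F -> nat := fun v => f v.

(** Encodes a transversal by the row of the 1 in each column; bounding rows by [K] makes the
    encodings a finite type. *)
Definition placement f : Prop :=
  [/\ injective f, forall v, (rows f v, v) \in cells Y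
    & forall r, (exists v, (r, v) \in cells Y) -> exists v, rows f v = r].

(* Reversing the order of the rows exchanges the two avoidance conditions, hence
   the direction parameter [d]. *)
Definition dir_leq (d : bool) (a b : nat) := if d then a <= b else b <= a.

Lemma dir_leq_below d a a' b : a < b -> a' < b ->
  dir_leq d a b = dir_leq d a' b /\ dir_leq d b a = dir_leq d b a'.
Proof. by rewrite /dir_leq; case: d; lia. Qed.

(* Interpolates between avoiding one set of patterns ([P] empty) and avoiding the
   other ([P] full). *)
Definition extremal (d : bool) (P : seq F) f : Prop :=
  forall y w, anc y w ->
    dominated (rows f) (f y) y -> dominated (rows f) (f w) y ->
    if y \in P then dir_leq d (f y) (f w) else dir_leq d (f w) (f y).

(** * Rotating the dominated 1s in the subtree of one vertex *)

Section Rotation.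
Variables (d : bool) (x : F).
Let le : rel 'I_K := fun a b => dir_leq d a b.

Definition subtree (w : F) := (w == x) || anc x w.

(** The set Q attached to [x]. The first conjunct empties it when the 1 of [x] is not dominated, so
    that rotation is then the identity. *)
Definition rotated_row f (r : nat) : Prop :=
  dominated (rows f) (f x) x /\
  exists w, [/\ subtree w, f w = r :> nat & dominated (rows f) r x].

Definition rotated_rows f : seq 'I_K :=
  [seq r : 'I_K <- sort le (enum 'I_K) | `[< rotated_row f r >]].

(** [next] fixes every row outside the list, so only the 1s in rotated rows move. *)
Definition rotate f : {ffun F -> 'I_K} :=
  [ffun v => next (rotated_rows f) (f v)].

Lemma dir_leq_refl : reflexive le.
Proof. by move=> a; rewrite /le /dir_leq; case: d => /=. Qed.

Lemma dir_leq_trans : transitive le.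
Proof. by move=> b a c; rewrite /le /dir_leq; case: d; lia. Qed.

Lemma dir_leq_anti : antisymmetric le.
Proof.
by move=> a b; rewrite /le /dir_leq; case: d => H; apply/val_inj => /=; lia.
Qed.

Lemma dir_leq_total : total le.
Proof. by move=> a b; rewrite /le /dir_leq; case: d; lia. Qed.

Lemma rotated_rows_uniq f : uniq (rotated_rows f).
Proof. by rewrite filter_uniq // sort_uniq enum_uniq. Qed.

Lemma rotated_rows_sorted f : sorted le (rotated_rows f).
Proof. exact/sorted_filter/sort_sorted/dir_leq_total/dir_leq_trans. Qed.

Lemma mem_rotated_rows f (r : 'I_K) : reflect (rotated_row f r) (r \in rotated_rows f).
Proof. by rewrite mem_filter mem_sort mem_enum andbT; apply: asboolP. Qed.

Lemma dominated_subtree (g : F -> nat) r w :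
  subtree w -> dominated g r x -> dominated g r w.
Proof. by case/orP => [/eqP->//|]; apply: dominated_desc. Qed.

Lemma rotate_id f : ~ dominated (rows f) (f x) x -> rotate f = f.
Proof.
move=> nd; apply/ffunP => v; rewrite ffunE next_nth ifF //.
by apply/mem_rotated_rows => -[].
Qed.

Section OfPlacement.
Variable f : {ffun F -> 'I_K}.
Hypothesis plf : placement f.
Let S := rotated_rows f.

Lemma rotated_subtree v : f v \in S -> subtree v.
Proof.
case: plf => f_inj _ _ /mem_rotated_rows[_ [w [xw fwv _]]].
by have <- : w = v by apply/f_inj/val_inj.
Qed.

Lemma rotated_dominated r : r \in S -> dominated (rows f) r x.
Proof. by case/mem_rotated_rows => _ [w []]. Qed.

Lemma rotated_preim r : r \in S -> exists2 w, subtree w & f w = r.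
Proof.
by case/mem_rotated_rows => _ [w [xw fw _]]; exists w => //; apply: val_inj.
Qed.

Lemma rotate_in v : (rotate f v \in S) = (f v \in S).
Proof. by rewrite ffunE mem_next. Qed.

Lemma rotate_notin v : f v \notin S -> rotate f v = f v.
Proof. by move=> nS; rewrite ffunE next_nth (negbTE nS). Qed.

(** A moved 1 belongs to the subtree of [x], and both its old and new rows are dominated in column
    [x], hence in its own column. *)
Lemma rotate_dominated r v :
  dominated (rows (rotate f)) r v <-> dominated (rows f) r v.
Proof.
apply: dominated_invariant => w.
case: (boolP (f w \in S)) => [wS|/rotate_notin wS]; last by left; rewrite /rows wS.
right; have xw := rotated_subtree wS; split; apply: dominated_subtree xw _.
  exact: rotated_dominated.
by apply: rotated_dominated; rewrite rotate_in.
Qed.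

(** Rotation only permutes the rows of Q among vertices of the subtree. Q can thus be read off the
    result, which makes [rotate] injective. *)
Lemma rotated_row_rotate r : rotated_row (rotate f) r <-> rotated_row f r.
Proof.
have [dx|nd] := pselect (dominated (rows f) (f x) x); last by rewrite rotate_id.
have xS : f x \in S.
  by apply/mem_rotated_rows; split=> //; exists x; rewrite /subtree eqxx.
split=> [[_ [w [xw fw /rotate_dominated dr]]]|fr].
  split=> //; case: (boolP (f w \in S)) => [|/rotate_notin wS].
    by rewrite -rotate_in => /mem_rotated_rows; rewrite fw => -[].
  by exists w; rewrite -wS.
split; first by apply/rotate_dominated/rotated_dominated; rewrite rotate_in.
have [w0 [xw0 fw0 dr]] := fr.2.
have rS : f w0 \in S by apply/mem_rotated_rows; rewrite fw0.
have : prev S (f w0) \in S by rewrite mem_prev.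
case/rotated_preim => w xw fw; exists w; split=> //.
  by rewrite ffunE fw next_prev ?rotated_rows_uniq.
exact/rotate_dominated.
Qed.

Lemma rotated_rows_rotate : rotated_rows (rotate f) = S.
Proof. by apply: eq_filter => r; apply/asboolP/asboolP => /rotated_row_rotate. Qed.

Lemma rotate_placement : placement (rotate f).
Proof.
case: plf => f_inj f_cell f_row; split.
- move=> u v; rewrite !ffunE => /(next_inj (rotated_rows_uniq f)); exact: f_inj.
- move=> v; case: (boolP (f v \in S)) => [vS|/rotate_notin vS].
    have /(dominated_subtree (rotated_subtree vS))[] // :
      dominated (rows f) (rotate f v) x.
    by apply: rotated_dominated; rewrite rotate_in.
  by rewrite /rows vS; apply: f_cell.
- move=> r /f_row[v fv].
  case: (boolP (f v \in S)) => [vS|/rotate_notin vS]; last first.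
    by exists v; rewrite /rows vS.
  have : prev S (f v) \in S by rewrite mem_prev.
  case/rotated_preim => w _ fw; exists w.
  by rewrite /rows ffunE fw next_prev ?rotated_rows_uniq.
Qed.

Lemma rotate_extremal (P : seq F) :
  x \notin P -> extremal d P f -> extremal d (x :: P) (rotate f).
Proof.
move=> xP ext; have [f_inj f_cell _] := plf.
have [dx|nd] := pselect (dominated (rows f) (f x) x); last first.
  rewrite rotate_id // => y w yw dy dw; rewrite inE.
  by case: eqP dy => [->//|_ dy]; apply: ext.
have subS w : subtree w -> dominated (rows f) (f w) x -> f w \in S.
  by move=> xw dw; apply/mem_rotated_rows; split=> //; exists w.
have xS : f x \in S by apply: subS => //; rewrite /subtree eqxx.
(* The condition at [x], which is not yet switched, says that its row is the [le]-greatest rotated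
   row. *)
have S_max b : b \in S -> le b (f x).
  move=> bS; have [w xw fw] := rotated_preim bS.
  case/orP: xw => [/eqP wx|xw]; first by rewrite -fw wx dir_leq_refl.
  rewrite -fw; have := ext x w xw dx; rewrite (negbTE xP); apply.
  by rewrite fw; apply: rotated_dominated.
move=> y w yw /rotate_dominated dy /rotate_dominated dw; rewrite inE.
(* At [x] itself the greatest row has wrapped around to the least one. *)
have [yx|nyx] /= := eqVneq y x.
  rewrite yx in dw *; rewrite [rotate f x]ffunE.
  suff wS : rotate f w \in S.
    exact: (next_max_min dir_leq_refl dir_leq_trans dir_leq_anti (rotated_rows_sorted f)
      (rotated_rows_uniq f) xS S_max wS).
  have xw : subtree w by rewrite /subtree -yx yw orbT.
  case: (boolP (f w \in S)) => [|wS]; first by rewrite -rotate_in.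
  by rewrite rotate_notin // in dw *; apply: subS.
(* Strict descendants of [x] avoid the greatest row, so [next] preserves order among those of them
   that move. *)
have [xy|nxy] := boolP (anc x y).
  have [sy sw] : subtree y /\ subtree w.
    by rewrite /subtree xy (anc_trans xy yw) !orbT.
  have neq v : anc x v -> f v != f x.
    by move=> xv; apply/eqP => /f_inj vx; move: xv; rewrite vx anc_irr.
  have nyw : f y != f w by apply/eqP => /f_inj eyw; move: yw; rewrite eyw anc_irr.
  have homo := next_homo dir_leq_refl dir_leq_trans dir_leq_anti (rotated_rows_sorted f)
    (rotated_rows_uniq f) xS S_max.
  (* Domination passes to smaller rows, so an unmoved 1 of the subtree has a larger row than all of
     [S]; comparing it with a moved 1 gives the same result before and after. *)
  have below r v : r \in S -> subtree v -> f v \notin S -> r < f v.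
    move=> /rotated_dominated rS sv /negP vS; rewrite ltnNge; apply/negP => vr.
    apply: vS; apply: subS => //; apply: dominated_row rS.
    by rewrite vr (cells_row_gt0 (f_cell v)).
  have inS v : f v \in S -> rotate f v \in S by rewrite rotate_in.
  move: (ext y w yw).
  case: (boolP (f y \in S)) (inS y) => [yS /(_ isT) ryS|yS _];
  case: (boolP (f w \in S)) (inS w) => [wS /(_ isT) rwS|wS _].
  - have dSy r : r \in S -> dominated (rows f) r y.
      by move=> /rotated_dominated; apply: dominated_desc.
    move=> /(_ (dSy _ yS) (dSy _ wS)); rewrite !ffunE.
    by case: (y \in P); apply: homo; rewrite // neq // (anc_trans xy yw).
  - have dSy r : r \in S -> dominated (rows f) r y.
      by move=> /rotated_dominated; apply: dominated_desc.
    rewrite (rotate_notin wS) in dw *; move=> /(_ (dSy _ yS) dw).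
    by have [-> ->] := dir_leq_below d (below _ _ yS sw wS) (below _ _ ryS sw wS).
  - have dSy r : r \in S -> dominated (rows f) r y.
      by move=> /rotated_dominated; apply: dominated_desc.
    rewrite (rotate_notin yS) in dy *; move=> /(_ dy (dSy _ wS)).
    by have [-> ->] := dir_leq_below d (below _ _ wS sy yS) (below _ _ rwS sy yS).
  - rewrite (rotate_notin wS) in dw *; rewrite (rotate_notin yS) in dy *.
    exact.
have yS : f y \notin S.
  by apply/negP => /rotated_subtree; rewrite /subtree (negbTE nyx) (negbTE nxy).
rewrite (rotate_notin yS) in dy *.
case: (boolP (f w \in S)) => [wS|wS]; last first.
  by rewrite (rotate_notin wS) in dw *; apply: ext.
have yx : anc y x.
  case/orP: (rotated_subtree wS) => [/eqP <-//|xw].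
  case: (anc_chain yw xw) => // [eyx|xy]; first by rewrite eyx eqxx in nyx.
  by rewrite xy in nxy.
(* The new row of [w] is the old row of some [w'] in the subtree of [x], still a strict descendant
   of [y], so the old condition for [y] and [w'] applies. *)
have : rotate f w \in S by rewrite rotate_in.
case/rotated_preim => w' xw' fw'; rewrite -fw' in dw *; apply: ext => //.
by case/orP: xw' => [/eqP->//|]; apply: anc_trans.
Qed.

End OfPlacement.

Lemma rotate_inj f g : placement f -> placement g -> rotate f = rotate g -> f = g.
Proof.
move=> plf plg efg.
have eS : rotated_rows f = rotated_rows g.
  by rewrite -(rotated_rows_rotate plf) efg rotated_rows_rotate.
apply/ffunP => v; apply: (next_inj (rotated_rows_uniq f)).
by move/ffunP/(_ v): efg; rewrite !ffunE eS.
Qed.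

End Rotation.

(** * Counting: switching all vertices one at a time *)

Definition num_extremal d P :=
  #|[pred f : {ffun F -> 'I_K} | `[< placement f /\ extremal d P f >]]|.

Lemma num_extremal_cons d x P :
  x \notin P -> num_extremal d P <= num_extremal d (x :: P).
Proof.
move=> xP; rewrite /num_extremal.
rewrite -(card_in_imset (f := rotate d x)); last first.
  by move=> f g /asboolP[plf _] /asboolP[plg _]; apply: rotate_inj.
apply/subset_leq_card/fintype.subsetP => _ /imsetP[f /asboolP[plf ext] ->].
by apply/asboolP; split; [apply: rotate_placement | apply: rotate_extremal].
Qed.

Lemma sub_num_extremal d d' P P' :
  (forall f, extremal d P f -> extremal d' P' f) ->
  num_extremal d P <= num_extremal d' P'.
Proof.
move=> H; apply/subset_leq_card/fintype.subsetP => f /asboolP[plf ext].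
by apply/asboolP; split=> //; apply: H.
Qed.

Lemma num_extremal_nil d P : uniq P -> num_extremal d [::] <= num_extremal d P.
Proof.
elim: P => //= x P IH /andP[xP /IH le_P].
exact: leq_trans le_P (num_extremal_cons _ xP).
Qed.

(** Switching every vertex turns direction [d] into [~~ d]. The resulting inequality holds for both
    directions, so injectivity of the rotations suffices. *)
Lemma num_extremal_flip : num_extremal true [::] = num_extremal false [::].
Proof.
suff H d : num_extremal d [::] <= num_extremal (~~ d) [::].
  by apply/eqP; rewrite eqn_leq !H.
apply: leq_trans (num_extremal_nil d (enum_uniq F)) _.
apply: sub_num_extremal => f ext y w yw dy dw.
by have := ext y w yw dy dw; rewrite mem_enum in_nil /dir_leq; case: (d).
Qed.

End Dominated.

(** * Transversals as placements, and pattern containment *)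

Section Labelings.
Variables (F : rooted_forest) (Y : forest_Young_diagram F) (K : nat).
Hypothesis K_bound : forall r v, (r, v) \in cells Y -> r < K.
Notation anc := (@strict_ancestor F).
Implicit Types f : {ffun F -> 'I_K}.

Definition placement_labeling f : labeling Y :=
  [ffun c => rows f (val c).2 == (val c).1].

Lemma placement_labelingE f r v (c_in : (r, v) \in cells Y) :
  placement_labeling f [` c_in]%fset = (rows f v == r).
Proof. by rewrite ffunE. Qed.

Lemma placement_transversal f :
  placement Y f -> is_FYD_transversal (placement_labeling f).
Proof.
case=> f_inj f_cell f_row; split=> [r /f_row[v fv]|v].
  have c_in : (r, v) \in cells Y by rewrite -fv.
  apply: (eq_card1 (x := [` c_in]%fset)) => c; rewrite !inE ffunE -val_eqE /=.
  case: (val c) => r' v' /=; rewrite xpair_eqE; apply/andP/andP.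
    case=> /eqP-> /eqP fv'; split=> //; apply/eqP/f_inj/val_inj.
    by apply: (etrans fv'); rewrite -fv.
  by case=> /eqP-> /eqP->; rewrite fv.
apply: (eq_card1 (x := [` f_cell v]%fset)) => c; rewrite !inE ffunE -val_eqE /=.
case: (val c) => r' v' /=; rewrite xpair_eqE; apply/andP/andP.
  by case=> /eqP-> /eqP->.
by case=> /eqP-> /eqP->.
Qed.

Lemma placement_labeling_inj f g : placement Y f ->
  placement_labeling f = placement_labeling g -> f = g.
Proof.
case=> _ f_cell _ efg; apply/ffunP => v; apply/val_inj/esym/eqP.
rewrite -/(rows f v) -/(rows g v).
by rewrite -(placement_labelingE g (f_cell v)) -efg placement_labelingE.
Qed.

Lemma transversal_placement (T : labeling Y) : is_FYD_transversal T ->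
  exists2 f, placement Y f & placement_labeling f = T.
Proof.
case=> T_row T_col.
have ex v : exists r : 'I_K, forall c : cells Y,
    ((val c).2 == v) && T c = (val c == (nat_of_ord r, v)).
  have [c cE] := mem_card1 (T_col v).
  have : c \in pred1 c by rewrite !inE.
  rewrite -cE inE => /andP[/eqP cv Tc].
  case ec: (val c) (valP c) cv => [r v'] /= rv' ev; rewrite ev in ec rv'.
  exists (Ordinal (K_bound rv')) => c'; move: (cE c'); rewrite !inE => ->.
  by rewrite -val_eqE ec.
have {ex}[f fE] := choice ex.
have cell v : (nat_of_ord (f v), v) \in cells Y.
  have [c cE] := mem_card1 (T_col v); have := cE c.
  by rewrite !inE eqxx fE => /eqP <-; apply: valP.
have labE : placement_labeling [ffun v => f v] = T.
  apply/ffunP => c; rewrite ffunE /rows ffunE.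
  have := fE (val c).2 c; rewrite eqxx /= => ->.
  by case: (val c) => r v /=; rewrite xpair_eqE eqxx andbT eq_sym.
exists [ffun v => f v] => //; split.
- move=> u v; rewrite !ffunE => fuv.
  have row : exists w, (nat_of_ord (f u), w) \in cells Y by exists u.
  have [c cE] := mem_card1 (T_row _ row).
  have cell_c w (e : f w = f u) : [` cell w]%fset = c.
    have Tw : T [` cell w]%fset.
      by have := fE w [` cell w]%fset; rewrite /= !eqxx.
    apply/eqP; have := cE [` cell w]%fset; rewrite !inE Tw andbT /= => <-.
    exact/eqP/congr1.
  have := cell_c u erefl; rewrite -(cell_c v (esym fuv)).
  by move=> /(congr1 val) [].
- by move=> v; rewrite /rows ffunE.
- move=> r row; have [c cE] := mem_card1 (T_row _ row); have := cE c.
  rewrite !inE eqxx => /andP[/eqP cr Tc]; exists (val c).2.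
  rewrite /rows ffunE -cr; have := fE (val c).2 c; rewrite eqxx Tc /=.
  by move=> /esym/eqP {2}->.
Qed.

Lemma num_avoidingE occ d (MM : set {k : nat & perm_matrix k}) :
  (forall f, placement Y f ->
     extremal Y occ d [::] f <->
     forall M, MM M -> ~ contains (placement_labeling f) (tagged M)) ->
  num_avoiding Y MM = num_extremal Y occ K d [::].
Proof.
move=> H; rewrite /num_extremal -(card_in_imset (f := placement_labeling)).
  apply: eq_card => T; apply/asboolP/imsetP => [[trT avT]|[f]].
    have [f plf fT] := transversal_placement trT; exists f => //.
    by apply/asboolP; split=> //; apply/(H f plf); rewrite fT.
  case/asboolP=> plf ext ->; split; first exact: placement_transversal.
  exact/H.
by move=> f g /asboolP[plf _] _; apply: placement_labeling_inj.
Qed.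

(** The matrix of [sigma] reverses values, so larger values of [sigma] correspond to smaller
    rows. *)
Lemma contains_placement f k (sigma : 'S_k) : placement Y f ->
  contains (placement_labeling f) (perm_matrix_of_perm sigma) <->
  exists v : 'I_k -> F,
    [/\ forall i j : 'I_k, i < j -> anc (v i) (v j),
        forall i j : 'I_k, (rows f (v i), v j) \in cells Y
      & forall i j : 'I_k, sigma i < sigma j -> rows f (v j) < rows f (v i)].
Proof.
case=> f_inj _ _; split.
  case=> v [r [v_anc r_lt vr]]; exists v.
  have fv j : rows f (v j) = r (rev_ord (sigma j)).
    have [c_in] := vr (rev_ord (sigma j)) j.
    by rewrite placement_labelingE mxE eqxx; case: eqP.
  split=> // i j; first by rewrite fv; have [] := vr (rev_ord (sigma i)) j.
  move=> ij; rewrite !fv; apply: r_lt => /=.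
  by have := ltn_ord (sigma j); lia.
case=> v [v_anc v_cell v_row].
have v_inj : injective v.
  move=> i j eij; apply/val_inj.
  by case: (ltngtP i j) => // /v_anc; rewrite eij anc_irr.
exists v, (fun i => rows f (v ((sigma^-1)%g (rev_ord i)))); split=> //.
  move=> i j ij; apply: v_row; rewrite !permKV /=.
  by have := ltn_ord j; lia.
move=> i j; exists (v_cell _ j); rewrite placement_labelingE mxE; congr nat_of_bool.
apply/eqP/eqP => [/val_inj/f_inj/v_inj->|->]; first by rewrite permKV rev_ordK.
by rewrite rev_ordK permK.
Qed.

(* The first [k - 2] columns of [sigma] are matched by [u] on vertices of [A];
   the values of [u] at the last two indices are junk. *)
Definition init_occurrence (k : nat) (sigma : 'S_k) (f : F -> nat)
    (A : F -> Prop) : Prop :=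
  exists u : 'I_k -> F,
    [/\ forall a : 'I_k, a.+2 < k -> A (u a),
        forall a b : 'I_k, a < b -> b.+2 < k -> anc (u a) (u b),
        forall a b : 'I_k, a.+2 < k -> b.+2 < k -> (f (u a), u b) \in cells Y
      & forall a b : 'I_k, a.+2 < k -> b.+2 < k -> sigma a < sigma b ->
          f (u b) < f (u a)].

Lemma init_occurrence_ext k (sigma : 'S_k) (f g : F -> nat) (A : F -> Prop) :
  (forall u, A u -> f u = g u) ->
  init_occurrence sigma f A -> init_occurrence sigma g A.
Proof.
move=> efg [u [uA u_anc u_cell u_row]]; exists u; split=> //.
  by move=> a b ak bk; rewrite -efg ?u_cell //; apply: uA.
by move=> a b ak bk /(u_row _ _ ak bk); rewrite !efg //; apply: uA.
Qed.

(** * Splitting off the last two columns of a pattern *)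

Section LastTwo.
(** [b] is true when the last two values increase and false when they are swapped; values are
    counted from 0. *)
Variables (k : nat) (k_ge2 : 1 < k) (sigma tau : 'S_k) (b : bool).
Hypothesis sigma_init : forall j : 'I_k, j.+2 < k -> sigma j = tau j.
Hypothesis sigma_penult : forall j : 'I_k, j.+2 = k -> sigma j + b.+1 = k.
Hypothesis sigma_last : forall j : 'I_k, j.+1 = k -> sigma j + (~~ b).+1 = k.

Let ord_cases (j : 'I_k) : [\/ j.+2 < k, j.+2 = k | j.+1 = k].
Proof.
have := ltn_ord j; case: (ltngtP j.+2 k) => jk; first by constructor 1.
  by move=> ltj; constructor 3; lia.
by constructor 2.
Qed.

(** The two largest values are already taken by the last two positions. *)
Lemma sigma_init_lt (j : 'I_k) : j.+2 < k -> (sigma j).+2 < k.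
Proof.
have ltp : k - 2 < k by lia. have ltq : k - 1 < k by lia.
pose p := Ordinal ltp; pose q := Ordinal ltq => jk.
have hp : sigma p + b.+1 = k by apply: sigma_penult => /=; lia.
have hq : sigma q + (~~ b).+1 = k by apply: sigma_last => /=; lia.
have np : (sigma j : nat) <> sigma p.
  by move/val_inj/perm_inj => /(congr1 val) /=; lia.
have nq : (sigma j : nat) <> sigma q.
  by move/val_inj/perm_inj => /(congr1 val) /=; lia.
by have := ltn_ord (sigma j); case: (b) hp hq => /=; lia.
Qed.

Lemma pattern_last_two (f : F -> nat) : (forall v, (f v, v) \in cells Y) ->
  (exists v : 'I_k -> F,
    [/\ forall i j : 'I_k, i < j -> anc (v i) (v j),
        forall i j : 'I_k, (f (v i), v j) \in cells Y
      & forall i j : 'I_k, sigma i < sigma j -> f (v j) < f (v i)]) <->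
  exists y w, [/\ anc y w, if b then f w < f y else f y < f w
    & dominated Y (init_occurrence tau) f (maxn (f y) (f w)) y].
Proof.
have ltp : k - 2 < k by lia. have ltq : k - 1 < k by lia.
pose p := Ordinal ltp; pose q := Ordinal ltq.
have ep : p.+2 = k by rewrite /=; lia.
have eq : q.+1 = k by rewrite /=; lia.
have hp := sigma_penult ep; have hq := sigma_last eq.
move=> f_cell; split.
  case=> v [v_anc v_cell v_row]; exists (v p), (v q); split.
  - by apply: v_anc; rewrite /=; lia.
  - by case: (b) hp hq => /= hp hq; apply: v_row; lia.
  split; first by case: leqP => _; apply: v_cell.
  exists (fun w => exists2 a : 'I_k, a.+2 < k & w = v a).
    exists v; split=> //; first by move=> a ak; exists a.
      by move=> a c ac _; apply: v_anc.
    by move=> a c ak ck; rewrite -!sigma_init //; apply: v_row.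
  move=> _ [a ak ->]; split; first by apply: v_anc; rewrite /=; lia.
  by have := sigma_init_lt ak; case: (b) hp hq => /= hp hq ?;
    rewrite gtn_max !v_row //; lia.
case=> y [w [yw fyw [m_cell [A [u [uA u_anc u_cell u_row]] Ay]]]].
have u_y (a : 'I_k) : a.+2 < k -> [/\ anc (u a) y, f y < f (u a) & f w < f (u a)].
  by move=> /uA/Ay[uy]; rewrite gtn_max => /andP[].
have u_w (a : 'I_k) : a.+2 < k -> anc (u a) w by move=> /u_y[/anc_trans H _ _]; apply: H.
have f_gt0 v : 0 < f v := cells_row_gt0 (f_cell v).
have below r r' v : (r, v) \in cells Y -> 0 < r' <= r -> (r', v) \in cells Y.
  exact: cells_column.
pose v (j : 'I_k) := if j.+2 < k then u j else if j.+2 == k then y else w.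
have v1 (j : 'I_k) : j.+2 < k -> v j = u j by rewrite /v => ->.
have v2 (j : 'I_k) : j.+2 = k -> v j = y.
  by move=> jk; rewrite /v jk ltnn eqxx.
have v3 (j : 'I_k) : j.+1 = k -> v j = w.
  by move=> jk; rewrite /v !ifF //; lia.
(* The one cell not implied by the cells of the 1s and of the stripped occurrence: it needs
   domination at the higher of the two rows. *)
have yy : (f w, y) \in cells Y.
  by apply: below m_cell _; rewrite f_gt0 leq_maxr.
exists v; split=> i j.
- case: (ord_cases i) => ik; case: (ord_cases j) => jk ij; try by exfalso; lia.
  + by rewrite !v1 //; apply: u_anc.
  + by rewrite v1 // v2 //; case: (u_y _ ik).
  + by rewrite v1 // v3 //; apply: u_w.
  + by rewrite v2 // v3.
- case: (ord_cases i) => ik; case: (ord_cases j) => jk;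
    rewrite ?(v1 _ ik) ?(v2 _ ik) ?(v3 _ ik) ?(v1 _ jk) ?(v2 _ jk) ?(v3 _ jk) //.
  + exact: u_cell.
  + by case: (u_y _ ik) => uy _ _; apply: cells_descendant uy.
  + by apply: cells_descendant (u_w _ ik).
  + by case: (u_y _ jk) => _ ? _; apply: below (f_cell _) _; rewrite f_gt0 ltnW.
  + exact: cells_descendant yw.
  + by case: (u_y _ jk) => _ _ ?; apply: below (f_cell _) _; rewrite f_gt0 ltnW.
- have pj (l : 'I_k) : l.+2 = k -> sigma l + b.+1 = k := @sigma_penult l.
  have qj (l : 'I_k) : l.+1 = k -> sigma l + (~~ b).+1 = k := @sigma_last l.
  case: (ord_cases i) => ik; case: (ord_cases j) => jk;
    rewrite ?(v1 _ ik) ?(v2 _ ik) ?(v3 _ ik) ?(v1 _ jk) ?(v2 _ jk) ?(v3 _ jk) //.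
  + by rewrite !sigma_init //; apply: u_row.
  + by case: (u_y _ ik).
  + by case: (u_y _ ik).
  + by have := sigma_init_lt jk; have := pj _ ik; case: (b) => /=; lia.
  + by have := pj _ ik; have := pj _ jk; lia.
  + by have := pj _ ik; have := qj _ jk; case: (b) fyw => /=; lia.
  + by have := sigma_init_lt jk; have := qj _ ik; case: (b) => /=; lia.
  + by have := qj _ ik; have := pj _ jk; case: (b) fyw => /=; lia.
  + by have := qj _ ik; have := qj _ jk; lia.
Qed.

End LastTwo.

End Labelings.

(** * Both avoidance counts as extremal counts, and the conclusion *)

Lemma cells_bound (F : rooted_forest) (Y : forest_Young_diagram F) :
  exists K, forall r v, (r, v) \in cells Y -> r < K.
Proof.
exists (\max_(c <- enum_fset (cells Y)) c.1).+1 => r v rv.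
rewrite ltnS.
exact: (@leq_bigmax_seq _ (enum_fset (cells Y)) (fun=> true) fst (r, v)).
Qed.

(** Domination is defined from [tau] whichever family [sigma] is, so the two counts to compare
    differ only in the direction [~~ b]. *)
Lemma num_avoiding_last_two (F : rooted_forest) (Y : forest_Young_diagram F)
    (K : nat) (I : Type) (k : I -> nat) (sigma tau : forall i, 'S_(k i))
    (b : bool) :
  (forall r v, (r, v) \in cells Y -> r < K) ->
  (forall i, 1 < k i) ->
  (forall i (j : 'I_(k i)), j.+2 < k i -> sigma i j = tau i j) ->
  (forall i (j : 'I_(k i)), j.+2 = k i -> sigma i j + b.+1 = k i) ->
  (forall i (j : 'I_(k i)), j.+1 = k i -> sigma i j + (~~ b).+1 = k i) ->
  num_avoiding Y (tagged_matrix_of_perm @`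
    [set Tagged (fun n => 'S_n) (sigma i) | i in [set: I]]) =
  num_extremal Y (fun f A => exists i, init_occurrence Y (tau i) f A) K
    (~~ b) [::].
Proof.
move=> K_bound k_ge2 s_init s_pen s_last; apply: num_avoidingE => // f plf.
have f_cell : forall v, (rows f v, v) \in cells Y by case: plf.
set occ := fun f A => _.
have containsE i := iff_trans (contains_placement (sigma i) plf)
  (pattern_last_two (k_ge2 i) (s_init i) (s_pen i) (s_last i) f_cell).
have f_gt0 v : 0 < rows f v := cells_row_gt0 (f_cell v).
split=> [ext _ [_ [i _ <-] <-] /containsE[y [w [yw fyw [m_cell [A tA Ay]]]]]|].
  have dm : dominated Y occ (rows f) (maxn (rows f y) (rows f w)) y.
    by split=> //; exists A => //; exists i.
  have dy : dominated Y occ (rows f) (f y) y.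
    by apply: dominated_row dm; rewrite f_gt0 leq_maxl.
  have dw : dominated Y occ (rows f) (f w) y.
    by apply: dominated_row dm; rewrite f_gt0 leq_maxr.
  have := ext y w yw dy dw; move: fyw; rewrite in_nil /dir_leq /rows.
  by case: (b) => /=; lia.
move=> av y w yw dy dw; rewrite in_nil.
case: (boolP (dir_leq _ _ _)) => // nle; exfalso.
have [m_cell [A [i tA] Ay]] :
    dominated Y occ (rows f) (maxn (rows f y) (rows f w)) y.
  by case: leqP => _.
apply: (av (tagged_matrix_of_perm (Tagged (fun n => 'S_n) (sigma i)))).
  by exists (Tagged (fun n => 'S_n) (sigma i)) => //; exists i.
apply/containsE; exists y, w; split=> //; last by split=> //; exists A.
by move: nle; rewrite /dir_leq /rows; case: (b) => /=; lia.
Qed.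

(* Indices are counted from 0, so that [j.+1] is the position written j in the
   usual numbering 1, ..., k. *)
Theorem theorem1p3 (m : nat) (m_gt0 : 0 < m) (k : 'I_m -> nat)
    (k_ge2 : forall i : 'I_m, 2 <= k i)
    (tau : forall i : 'I_m, {perm 'I_(k i)})
    (tau_penult : forall (i : 'I_m) (j : 'I_(k i)),
       j.+1 = k i - 1 -> (tau i j).+1 = k i - 1)
    (tau_last : forall (i : 'I_m) (j : 'I_(k i)),
       j.+1 = k i -> (tau i j).+1 = k i)
    (tau' : forall i : 'I_m, {perm 'I_(k i)})
    (tau'_init : forall (i : 'I_m) (j : 'I_(k i)),
       1 <= j.+1 <= k i - 2 -> tau' i j = tau i j)
    (tau'_penult : forall (i : 'I_m) (j : 'I_(k i)),
       j.+1 = k i - 1 -> (tau' i j).+1 = k i)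
    (tau'_last : forall (i : 'I_m) (j : 'I_(k i)),
       j.+1 = k i -> (tau' i j).+1 = k i - 1) :
  perms_forest_shape_Wilf_equivalent
    [set Tagged (fun n => {perm 'I_n}) (tau i) | i in [set: 'I_m]]
    [set Tagged (fun n => {perm 'I_n}) (tau' i) | i in [set: 'I_m]].
Proof.
move=> F Y; have [K K_bound] := cells_bound Y.
rewrite (num_avoiding_last_two (tau := tau) (b := true) K_bound k_ge2) //=; first last.
- by move=> i j jk; have := tau_last i j jk; lia.
- by move=> i j jk; have := tau_penult i j; lia.
rewrite (num_avoiding_last_two (tau := tau) (b := false) K_bound k_ge2) /=; first last.
- by move=> i j jk; have := tau'_last i j jk; have := k_ge2 i; lia.
- by move=> i j jk; have := tau'_penult i j; lia.
- by move=> i j jk; apply: tau'_init; lia.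
apply/esym/num_extremal_flip => f g A efg [i iA]; exists i.
exact: init_occurrence_ext efg iA.
Qed.
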